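(* Let $p$ be an odd prime, $q\in\mathbb{C}_p$ with $q\neq 1$ and $|q-1|_p<p^{-1/(p-1)}$, $\lambda\in\mathbb{C}_p$ with $\lambda\ne 0$, and $x\in\mathbb{C}_p$ with $|x|_p\le 1$. For every integer $n\ge 0$, $$q\,E_{n,q}(x+1|\lambda)+E_{n,q}(x|\lambda)=[2]_q\left([x]_q\right)_{n,\lambda}.$$
   Context: $\mathbb{Z}_p$ is the ring of $p$-adic integers and $\mathbb{C}_p$ the completion of the algebraic closure of $\mathbb{Q}_p$, with $|p|_p=1/p$. For $|z|_p\le 1$, $q^z=\exp(z\log q)$ and $[z]_q=\frac{1-q^z}{1-q}$ (so $[2]_q=1+q$); also $[N]_{-q}=\frac{1-(-q)^N}{1+q}$ for integers $N\ge 0$. The fermionic $p$-adic $q$-integral of a continuous function $f:\mathbb{Z}_p\to\mathbb{C}_p$ is $$\int_{\mathbb{Z}_p}f(y)\,d\mu_{-q}(y)=\lim_{N\to\infty}\frac{1}{[p^N]_{-q}}\sum_{y=0}^{p^N-1}f(y)(-q)^y .$$ The degenerate $q$-Euler polynomials $E_{n,q}(x|\lambda)$ are defined by the generating function $$\int_{\mathbb{Z}_p}(1+\lambda t)^{\frac{1}{\lambda}[x+y]_q}\,d\mu_{-q}(y)=\sum_{n=0}^\infty E_{n,q}(x|\lambda)\frac{t^n}{n!},$$ where $(1+\lambda t)^{z/\lambda}=\exp\left(\frac{z}{\lambda}\log(1+\lambda t)\right)$ is expanded as a power series in $t$ and the integral is taken coefficientwise. The degenerate falling factorial is $(z)_{n,\lambda}=z(z-\lambda)(z-2\lambda)\cdots(z-(n-1)\lambda)$,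 with $(z)_{0,\lambda}=1$. *)

(* Defs.v *)
From HB Require Import structures.
From mathcomp Require Import all_boot all_order all_algebra.
From mathcomp Require Import all_classical all_reals all_analysis.
Set Implicit Arguments.
Unset Strict Implicit.
Unset Printing Implicit Defensive.
Import Order.TTheory GRing.Theory Num.Theory.
Import numFieldNormedType.Exports.
Local Open Scope classical_set_scope.
Local Open Scope ring_scope.

(** * Non-archimedean valued fields *)

(* The normed structures of the libraries cannot carry such an absolute value:
   they require [`|x *+ n| = `|x| *+ n]. *)
HB.mixin Record isNonarchimedean (R : realType) K & GRing.Field K := {
  vabs : K -> R ;
  vabs_ge0 : forall x : K, 0 <= vabs x ;
  vabs_eq0 : forall x : K, vabs x = 0 <-> x = 0 ;
  vabsM : forall x y : K, vabs (x * y) = vabs x * vabs y ;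
  vabsD_max : forall x y : K, vabs (x + y) <= Num.max (vabs x) (vabs y)
}.

#[short(type="valuedFieldType")]
HB.structure Definition ValuedField (R : realType) :=
  {K of GRing.Field K & isNonarchimedean R K}.

Section ValuedFieldTheory.
Context {R : realType} {K : valuedFieldType R}.
Implicit Types x y z : K.

Lemma vabs0 : vabs (0 : K) = 0 :> R. Proof. exact/vabs_eq0. Qed.

Lemma vabs1 : vabs (1 : K) = 1 :> R.
Proof.
have n0 : vabs (1 : K) != 0 :> R.
  by apply/eqP => /vabs_eq0/eqP; rewrite oner_eq0.
by apply: (mulfI n0); rewrite mulr1 -vabsM mulr1.
Qed.

Lemma vabsN x : vabs (- x) = vabs x :> R.
Proof.
suff N1 : vabs (-1 : K) = 1 :> R by rewrite -mulN1r vabsM N1 mul1r.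
apply/eqP; rewrite -(@eqrXn2 _ 2)// ?vabs_ge0// expr1n expr2 -vabsM.
by rewrite mulrNN mulr1 vabs1.
Qed.

Lemma vabsBC x y : vabs (x - y) = vabs (y - x) :> R.
Proof. by rewrite -vabsN opprB. Qed.

Lemma vabsD x y : vabs (x + y) <= vabs x + vabs y :> R.
Proof.
by rewrite (le_trans (vabsD_max _ _))// ge_max lerDl lerDr !vabs_ge0.
Qed.

Lemma vabs_nat_le1 (m : nat) : vabs (m%:R : K) <= 1 :> R.
Proof.
elim: m => [|m IHm]; first by rewrite vabs0 ler01.
by rewrite -natr1 (le_trans (vabsD_max _ _))// ge_max IHm vabs1 lexx.
Qed.

End ValuedFieldTheory.

(* [K] as a metric space, for the distance [vabs (x - y)]; this is an alias
   because the libraries provide no join of [fieldType] and [metricType]. *)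
Definition vtop (R : realType) (K : valuedFieldType R) : Type := K.

Section ValuedFieldTopology.
Context {R : realType} {K : valuedFieldType R}.

Let vdist (x y : vtop K) : R := vabs ((x : K) - (y : K)).

Let vdistxx x : vdist x x = 0.
Proof. by rewrite /vdist subrr vabs0. Qed.

Let vdist_eq0 x y : vdist x y = 0 -> x = y.
Proof. by move=> /vabs_eq0/subr0_eq. Qed.

Let vdist_sym x y : vdist x y = vdist y x.
Proof. exact: vabsBC. Qed.

Let vdist_triangle y x z : vdist x z <= vdist x y + vdist y z.
Proof. by rewrite /vdist -[x in leLHS](subrK (y : K)) -addrA vabsD. Qed.

HB.instance Definition _ := Choice.copy (vtop K) K.
HB.instance Definition _ := isPointed.Build (vtop K) (0 : K).
HB.instance Definition _ :=
  isMetric.Build R (vtop K) vdistxx vdist_eq0 vdist_sym vdist_triangle.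

End ValuedFieldTopology.

Definition vlim (R : realType) (K : valuedFieldType R) (u : nat -> K) : K :=
  limn (u : nat -> vtop K).

Lemma vcvgP (R : realType) (K : valuedFieldType R) (u : nat -> K) (l : K) :
  ((u : nat -> vtop K) @ \oo --> (l : vtop K)) <->
  (vabs (u n - l) @[n --> \oo] --> (0 : R)).
Proof.
have bE (x y : vtop K) (e : R) : ball x e y = (vabs ((x : K) - y) < e) :> Prop.
  by rewrite ballEmdist.
split=> [/cvg_ballP h|/cvgrPdist_lt h].
  apply/cvgrPdist_lt => e e0; near=> n.
  rewrite sub0r normrN ger0_norm ?vabs_ge0// vabsBC -bE.
  by near: n; exact: h.
apply/cvg_ballP => e e0; near=> n; rewrite bE vabsBC.
have : `|0 - vabs (u n - l)| < e by near: n; exact: h.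
by rewrite sub0r normrN ger0_norm ?vabs_ge0.
Unshelve. all: by end_near. Qed.

Lemma vcvg_lim (R : realType) (K : valuedFieldType R) (u : nat -> K) (l : K) :
  vabs (u n - l) @[n --> \oo] --> (0 : R) -> vlim u = l.
Proof. by move=> /vcvgP; apply: cvg_lim; exact: metric_hausdorff. Qed.

Definition vcomplete (R : realType) (K : valuedFieldType R) : Prop :=
  forall F : set_system (vtop K), ProperFilter F -> cauchy F -> cvg F.

(** * The fields Q_p and C_p *)

Definition padic_abs (R : realType) (p : nat) (r : rat) : R :=
  if r == 0 then 0
  else p%:R ^+ logn p `|denq r|%N / p%:R ^+ logn p `|numq r|%N.

(* [L] is the completion of the field [K] for the absolute value [v]. *)
Definition is_completion (R : realType) (K : fieldType) (v : K -> R)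
    (L : valuedFieldType R) (i : {rmorphism K -> L}) : Prop :=
  [/\ forall x, vabs (i x) = v x, vcomplete L & dense (range i : set (vtop L))].

(* [L] is an algebraic closure of [K], with an absolute value extending that
   of [K]. *)
Definition is_algebraic_closure (R : realType) (K L : valuedFieldType R)
    (i : {rmorphism K -> L}) : Prop :=
  [/\ GRing.closed_field_axiom L,
      forall y : L, algebraicOver i y
    & forall x, vabs (i x) = vabs x].

(* Q_p, an algebraic closure of Q_p and C_p are each determined up to isometric
   isomorphism; a term of this type is a choice of these three fields together
   with the embeddings Q -> Q_p -> algebraic closure -> C_p. *)
Record padicTower (R : realType) (p : nat) := PadicTower {
  Qp : valuedFieldType R ;
  Qpbar : valuedFieldType R ;
  Cp : valuedFieldType R ;
  rat_to_Qp : {rmorphism rat -> Qp} ;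
  Qp_to_Qpbar : {rmorphism Qp -> Qpbar} ;
  Qpbar_to_Cp : {rmorphism Qpbar -> Cp} ;
  Qp_completion : is_completion (padic_abs R p) rat_to_Qp ;
  Qpbar_closure : is_algebraic_closure Qp_to_Qpbar ;
  Cp_completion : is_completion vabs Qpbar_to_Cp
}.

Definition Zp (R : realType) (p : nat) (T : padicTower R p) : Type :=
  {z : Qp T | vabs z <= 1}.

Definition Zp_nat (R : realType) (p : nat) (T : padicTower R p) (m : nat) :
  Zp T := exist _ (m%:R : Qp T) (vabs_nat_le1 m).

Definition Zp_to_Cp (R : realType) (p : nat) (T : padicTower R p) (y : Zp T) :
  Cp T := Qpbar_to_Cp T (Qp_to_Qpbar T (sval y)).

(** * q-numbers *)

Definition padic_exp (R : realType) (K : valuedFieldType R) (z : K) : K :=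
  vlim (series (fun k => z ^+ k / k`!%:R)).

(* The term of index 0 vanishes since [0%:R^-1 = 0]. *)
Definition padic_log (R : realType) (K : valuedFieldType R) (z : K) : K :=
  vlim (series (fun k => (-1) ^+ k.+1 * (z - 1) ^+ k / k%:R)).

Definition qpow (R : realType) (K : valuedFieldType R) (q z : K) : K :=
  padic_exp (z * padic_log q).

Definition qnum (R : realType) (K : valuedFieldType R) (q z : K) : K :=
  (1 - qpow q z) / (1 - q).

Definition qnum_neg (K : fieldType) (q : K) (N : nat) : K :=
  (1 - (- q) ^+ N) / (1 + q).

Definition fermionic_integral (R : realType) (p : nat) (T : padicTower R p)
    (q : Cp T) (f : Zp T -> Cp T) : Cp T :=
  vlim (fun N => (qnum_neg q (p ^ N))^-1 *
                 \sum_(0 <= y < p ^ N) f (Zp_nat T y) * (- q) ^+ y).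

(** * Formal power series, as sequences of coefficients *)

Definition fps (K : fieldType) := nat -> K.

Definition fps_mul (K : fieldType) (u v : fps K) : fps K :=
  fun n => \sum_(i < n.+1) u i * v (n - i)%N.

Definition fps_pow (K : fieldType) (u : fps K) (k : nat) : fps K :=
  iter k (fps_mul u) (fun n => (n == 0)%:R).

(* For a series [u] without constant term, [u ^ k] has no coefficient in degree
   less than [k], so the sum over [k <= n] is the full exponential sum. *)
Definition fps_exp (K : fieldType) (u : fps K) : fps K :=
  fun n => \sum_(k < n.+1) fps_pow u k n / k`!%:R.

(* log (1 + lambda t); the constant term vanishes since [0%:R^-1 = 0]. *)
Definition fps_log1p (K : fieldType) (lambda : K) : fps K :=
  fun k => (-1) ^+ k.+1 * lambda ^+ k / k%:R.

(* (1 + lambda t) ^ (z / lambda) *)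
Definition fps_degenerate_exp (K : fieldType) (lambda z : K) : fps K :=
  fps_exp (fun k => z / lambda * fps_log1p lambda k).

(** * Degenerate q-Euler polynomials *)

(* The coefficient of [t ^ n] in the coefficientwise integral of
   (1 + lambda t) ^ ([x + y]_q / lambda) is E_n / n!. *)
Definition degenerate_qEuler (R : realType) (p : nat) (T : padicTower R p)
    (q lambda : Cp T) (n : nat) (x : Cp T) : Cp T :=
  n`!%:R * fermionic_integral q
    (fun y => fps_degenerate_exp lambda (qnum q (x + Zp_to_Cp y)) n).

Definition degenerate_ffact (K : fieldType) (lambda z : K) (n : nat) : K :=
  \prod_(i < n) (z - i%:R * lambda).

(* Main.v *)
(* The coefficient of t^n in (1 + lambda t)^(z / lambda) is
   (z)_{n,lambda} / n!, because G = exp ((z / lambda) log (1 + lambda t))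
   satisfies (1 + lambda t) G' = z G. Since q^(x + y) = q^x q^y, the integrand
   defining E_n is therefore a polynomial P evaluated at q^x q^y, and a
   geometric sum gives
     E_n(x) = sum_j P_j (q^x)^j (1 + q) / (1 + q^(j + 1)).
   In q E_n(x + 1) + E_n(x) the denominators cancel, which leaves
   (1 + q) P(q^x) = [2]_q ([x]_q)_{n,lambda}.
   That exp is multiplicative on the disc of radius p^(-1/(p-1)) and that
   exp (log q) = q are obtained on truncations: the relevant polynomial
   identities hold up to degree n, and the coefficients beyond degree n are
   controlled by a Gauss norm. *)
Require Import Defs.
From mathcomp Require Import all_boot all_order all_algebra.
From mathcomp Require Import all_classical all_reals all_analysis.
From mathcomp Require Import ring zify.
Set Implicit Arguments.
Unset Strict Implicit.
Unset Printing Implicit Defensive.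
Import Order.TTheory GRing.Theory Num.Theory.
Import numFieldNormedType.Exports.
Local Open Scope ring_scope.

(** * The degenerate exponential series *)

Section DegenerateExponential.
Context {K : fieldType} (char0 : [pchar K] =i pred0).
Implicit Types (lambda z : K) (n : nat).

(** Truncation at degree [n] of (z / lambda) log (1 + lambda t). With [lambda] and [z] equal to 1 it
    also serves as the truncated p-adic logarithm. *)
Definition log1p_poly lambda z n : {poly K} :=
  \poly_(i < n.+1) (z / lambda * fps_log1p lambda i).

(** Its degree may exceed [n]; agreement with (1 + lambda t)^(z / lambda) is used only up to degree
    [n]. *)
Definition degenerate_exp_poly lambda z n : {poly K} :=
  \sum_(k < n.+1) k`!%:R^-1 *: log1p_poly lambda z n ^+ k.

(** Coefficients of a product up to degree [N] involve only those of the factors up to degree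
    [N]. *)
Lemma coef_fps_pow (u : fps K) N k m : (m <= N)%N ->
  fps_pow u k m = ((\poly_(i < N.+1) u i) ^+ k)`_m.
Proof.
elim: k m => [|k IHk] m mN; first by rewrite expr0 coef1.
rewrite exprS coefM [LHS]/= /fps_mul; apply: eq_bigr => i _.
have iN : (i < N.+1)%N by rewrite ltnS (leq_trans _ mN)// -ltnS ltn_ord.
by rewrite coef_poly iN IHk// (leq_trans (leq_subr _ _)).
Qed.

Lemma fps_degenerate_exp_coef lambda z n :
  fps_degenerate_exp lambda z n = (degenerate_exp_poly lambda z n)`_n.
Proof.
rewrite /fps_degenerate_exp /fps_exp coef_sum; apply: eq_bigr => k _.
by rewrite (coef_fps_pow _ _ (leqnn n)) coefZ mulrC.
Qed.

Lemma natr_neq0 m : (m.+1%:R : K) != 0.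
Proof. by have/pcharf0P-> := char0. Qed.

Lemma factr_neq0 m : (m`!%:R : K) != 0.
Proof. by have/pcharf0P-> := char0; rewrite -lt0n fact_gt0. Qed.

Lemma log1p_poly0 lambda z n : (log1p_poly lambda z n)`_0 = 0.
Proof. by rewrite coef_poly /= /fps_log1p invr0 !mulr0. Qed.

(** Without constant term the polynomial is divisible by t, so its k-th power is divisible by
    t^k. *)
Lemma coef_log1p_exp lambda z n k m : (m < k)%N ->
  (log1p_poly lambda z n ^+ k)`_m = 0.
Proof.
move=> mk; set P := log1p_poly _ _ _.
have -> : P = drop_poly 1 P * 'X^1.
  apply/polyP => i; rewrite coefMXn coef_drop_poly.
  by case: i => [|i]; [rewrite log1p_poly0 | rewrite /= subn1 addn1].
by rewrite exprMn -exprM mul1n coefMXn mk.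
Qed.

(** The full series has derivative z / (1 + lambda t); truncation disturbs it only from degree [n]
    on. *)
Lemma coef_log1p_deriv lambda z n m : lambda != 0 -> (m < n)%N ->
  ((1 + lambda *: 'X) * (log1p_poly lambda z n)^`())`_m = z * (m == 0)%:R.
Proof.
move=> l0 mn; have dP i : (i < n)%N ->
    ((log1p_poly lambda z n)^`())`_i = z * (- lambda) ^+ i.
  move=> ltin; rewrite coef_deriv coef_poly ltnS ltin /fps_log1p.
  rewrite -[LHS]mulr_natr (exprNn lambda) !exprS; have := natr_neq0 i.
  by move: (i.+1%:R) => c c0; field; rewrite l0 c0.
rewrite mulrDl mul1r -scalerAl coefD coefZ coefXM dP//.
case: m mn => [|m] mn /=; first by rewrite expr0 mulr0 addr0.
by rewrite dP 1?ltnW// exprS; ring.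
Qed.

(** This is the equation (1 + lambda t) G' = z G read in degree [m]. *)
Lemma degenerate_exp_coefS lambda z n m : lambda != 0 -> (m < n)%N ->
  m.+1%:R * (degenerate_exp_poly lambda z n)`_m.+1 =
  (z - m%:R * lambda) * (degenerate_exp_poly lambda z n)`_m.
Proof.
move=> l0 mn; set G := degenerate_exp_poly _ _ _.
(* Differentiating the exponential sum lowers its index by one, so [H] lacks the last term P^n / n!,
   which has no coefficient below degree [n]. *)
set P := log1p_poly lambda z n; set H := G - n`!%:R^-1 *: P ^+ n.
have dG : G^`() = P^`() * H.
  rewrite /H /G /degenerate_exp_poly -/P [in RHS]big_ord_recr /= addrK.
  rewrite raddf_sum /=.
  rewrite big_ord_recl /= expr0 derivZ -polyC1 derivC scaler0 add0r.
  rewrite mulr_sumr; apply: eq_bigr => k _; rewrite /bump add1n.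
  rewrite derivZ deriv_exp /= -[_ *+ k.+1]scaler_nat scalerA -scalerAr.
  by rewrite factS natrM invfM mulrAC mulVf ?natr_neq0// mul1r.
have Hm : H`_m = G`_m by rewrite coefB coefZ coef_log1p_exp// mulr0 subr0.
have E : ((1 + lambda *: 'X) * G^`())`_m = z * G`_m.
  have ltin (i : 'I_m.+1) : (i < n)%N by exact: leq_trans mn.
  rewrite dG mulrA coefM big_ord_recl subn0 big1 => [|i _].
    by rewrite coef_log1p_deriv// mulr1 addr0 Hm.
  by rewrite coef_log1p_deriv// mulr0 mul0r.
move: E; rewrite mulrDl mul1r -scalerAl coefD coefZ coefXM !coef_deriv.
rewrite mulrBl => <-; rewrite mulr_natl; case: m mn Hm => [|m] _ _.
  by rewrite eqxx mulr0 !mul0r addr0 subr0.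
by rewrite /= mulr_natl mulrnAl mulrnAr addrK.
Qed.

Lemma degenerate_exp_coef lambda z n m : lambda != 0 -> (m <= n)%N ->
  (degenerate_exp_poly lambda z n)`_m = degenerate_ffact lambda z m / m`!%:R.
Proof.
move=> l0; elim: m => [|m IHm] mn.
  rewrite /degenerate_ffact big_ord0 mul1r invr1 coef_sum big_ord_recl.
  rewrite expr0 coefZ coef1 invr1 mulr1 big1 ?addr0// => i _.
  by rewrite coefZ coef_log1p_exp// mulr0.
apply: (mulfI (natr_neq0 m)); rewrite degenerate_exp_coefS// IHm 1?ltnW//.
rewrite /degenerate_ffact big_ord_recr /= factS natrM invfM.
by rewrite [RHS]mulrCA mulVKf ?natr_neq0// mulrA [in LHS](mulrC (z - _)).
Qed.

Lemma fps_degenerate_expE lambda z n : lambda != 0 ->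
  fps_degenerate_exp lambda z n = degenerate_ffact lambda z n / n`!%:R.
Proof. by move=> l0; rewrite fps_degenerate_exp_coef degenerate_exp_coef. Qed.

End DegenerateExponential.

(** * Convergence in a complete valued field *)

Section Convergence.
Context {R : realType} {K : valuedFieldType R}.
Implicit Types (u v : nat -> K) (l m : K).
Local Open Scope classical_set_scope.

Lemma vabsB_max (x y : K) : vabs (x - y) <= Num.max (vabs x) (vabs y) :> R.
Proof. by rewrite -(vabsN y) vabsD_max. Qed.

Lemma vabsX (x : K) k : vabs (x ^+ k) = vabs x ^+ k :> R.
Proof. by elim: k => [|k IH]; rewrite ?vabs1// !exprS vabsM IH. Qed.

Lemma vabsV (a : K) : vabs a^-1 = (vabs a)^-1 :> R.
Proof.
have [->|a0] := eqVneq a 0; first by rewrite invr0 vabs0 invr0.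
have va0 : vabs a != 0 :> R by apply: contra_neq a0 => /vabs_eq0.
by apply: (mulfI va0); rewrite divff// -vabsM divff// vabs1.
Qed.

Lemma vabs_sum_le (I : Type) (s : seq I) (P : pred I) (F : I -> K) (B : R) :
  0 <= B -> (forall i, P i -> vabs (F i) <= B) ->
  vabs (\sum_(i <- s | P i) F i) <= B :> R.
Proof.
move=> B0 FB; elim/big_ind : _ => [|x y xB yB|//]; first by rewrite vabs0.
by rewrite (le_trans (vabsD_max _ _))// ge_max xB.
Qed.

Definition vcvg u l : Prop := vabs (u n - l) @[n --> \oo] --> (0 : R).

Lemma vcvg_le u l (e : nat -> R) :
  (forall n, vabs (u n - l) <= e n) -> e @ \oo --> (0 : R) -> vcvg u l.
Proof.
move=> ue e0; rewrite /vcvg.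
apply: (squeeze_cvgr (f := fun=> 0) (h := e)) => //.
  by near=> n; rewrite vabs_ge0 ue.
exact: cvg_cst.
Unshelve. all: by end_near. Qed.

Lemma vcvg_geometric u l (c rho : R) : 0 <= rho < 1 ->
  (forall n, vabs (u n - l) <= c * rho ^+ n) -> vcvg u l.
Proof.
move=> /andP[r0 r1] h; apply: (vcvg_le h); apply: cvg_geometric.
by rewrite ger0_norm.
Qed.

Lemma vcvg_cst l : vcvg (fun=> l) l.
Proof.
apply: (@vcvg_le _ _ (fun=> 0)) => [n|]; first by rewrite subrr vabs0.
exact: cvg_cst.
Qed.

Lemma vcvg_unique u l m : vcvg u l -> vcvg u m -> l = m.
Proof. by move=> /vcvg_lim <- /vcvg_lim. Qed.

Lemma vcvgD u v l m : vcvg u l -> vcvg v m -> vcvg (fun n => u n + v n) (l + m).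
Proof.
move=> ul vm; apply: (@vcvg_le _ _ (fun n => vabs (u n - l) + vabs (v n - m))).
  by move=> n; rewrite opprD addrACA vabsD.
by rewrite -[0]addr0; apply: cvgD.
Qed.

Lemma vcvgM u v l m : vcvg u l -> vcvg v m -> vcvg (fun n => u n * v n) (l * m).
Proof.
move=> ul vm; apply: (@vcvg_le _ _ (fun n =>
  (vabs (u n - l) + vabs l) * vabs (v n - m) + vabs (u n - l) * vabs m)).
  move=> n; have -> : u n * v n - l * m =
    ((u n - l) + l) * (v n - m) + (u n - l) * m by ring.
  by rewrite (le_trans (vabsD _ _))// !vabsM lerD// ler_wpM2r ?vabs_ge0// vabsD.
have -> : (0 : R) = (0 + vabs l) * 0 + 0 * vabs m by rewrite mulr0 mul0r addr0.
apply: cvgD; apply: cvgM => //; last exact: cvg_cst.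
by apply: cvgD => //; exact: cvg_cst.
Qed.

Lemma vcvgMl (a : K) u l : vcvg u l -> vcvg (fun n => a * u n) (a * l).
Proof. by apply: vcvgM; exact: vcvg_cst. Qed.

Lemma vcvg_sum k (u : nat -> nat -> K) (l : nat -> K) :
  (forall i, vcvg (u i) (l i)) ->
  vcvg (fun n => \sum_(i < k) u i n) (\sum_(i < k) l i).
Proof.
move=> ul; elim: k => [|k IHk].
  by under eq_fun do rewrite big_ord0; rewrite big_ord0; exact: vcvg_cst.
by under eq_fun do rewrite big_ord_recr; rewrite big_ord_recr; exact: vcvgD.
Qed.

Lemma vcvg_shift u l : vcvg u l -> vcvg (fun n => u n.+1) l.
Proof. by rewrite /vcvg -[X in X -> _](cvg_shiftS _). Qed.

Lemma vcvg_lim_le u l (B : R) :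
  vcvg u l -> (forall n, vabs (u n) <= B) -> vabs l <= B.
Proof.
move=> ul uB; apply/ler_addgt0Pl => e e0.
have /cvgrPdist_lt/(_ e e0)[N _ /(_ N)] := ul.
rewrite /= leqnn sub0r normrN ger0_norm ?vabs_ge0// => /(_ isT) h.
rewrite -(subrK (u N) l) (le_trans (vabsD _ _))// lerD// vabsBC.
exact: ltW.
Qed.

(** By the ultrametric inequality the tail from [m] on is at most c rho^m, so the partial sums are
    Cauchy. *)
Lemma vseries_cvg (a : nat -> K) (c rho : R) : vcomplete K -> 0 <= rho < 1 ->
  (forall k, vabs (a k) <= c * rho ^+ k) ->
  vcvg (series a) (vlim (series a)).
Proof.
move=> Kc /andP[r0 r1] ac.
have c0 : 0 <= c.
  by rewrite -[c]mulr1 -[1](expr0 rho) (le_trans _ (ac 0%N)) ?vabs_ge0.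
have tail (m n : nat) : (m <= n)%N ->
      vabs (series a n - series a m) <= c * rho ^+ m.
  move=> mn; rewrite /series /= (big_cat_nat (n := m))//= addrAC subrr add0r.
  rewrite big_seq_cond; apply: vabs_sum_le => [|i].
    by rewrite mulr_ge0 ?exprn_ge0.
  rewrite andbT mem_index_iota => /andP[mi _].
  by rewrite (le_trans (ac i))// ler_wpM2l// ler_wiXn2l// ltW.
have cr0 : (c * rho ^+ n) @[n --> \oo] --> (0 : R).
  by apply: cvg_geometric; rewrite ger0_norm.
have : cvg ((series a : nat -> vtop K) @ \oo).
  apply: Kc; apply/cauchy_exP => e e0.
  have /cvgrPdist_lt/(_ e e0)[N _ cN] := cr0.
  exists (series a N : vtop K); exists N => // n /= Nn.
  rewrite ballEmdist /= /mdist /= vabsBC (le_lt_trans (tail _ _ Nn))//.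
  have := cN N (leqnn N).
  by rewrite /= sub0r normrN ger0_norm// mulr_ge0 ?exprn_ge0.
by move=> h; apply/vcvgP; exact: h.
Qed.

End Convergence.

(** * Gauss norms *)

Section GaussNorm.
Context {R : realType} {K : valuedFieldType R}.
Implicit Types (P Q : {poly K}) (w A B : R).

(** An upper bound for the Gauss norm of radius [w], which is the maximum of |P_i| w^i. *)
Definition gauss_le w B P := forall i, vabs P`_i * w ^+ i <= B.

Lemma gauss_leD w B P Q : 0 <= w ->
  gauss_le w B P -> gauss_le w B Q -> gauss_le w B (P + Q).
Proof.
move=> w0 PB QB i; rewrite coefD.
rewrite (le_trans (ler_wpM2r _ (vabsD_max _ _))) ?exprn_ge0//.
by rewrite maxr_pMl ?exprn_ge0// ge_max PB QB.
Qed.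

Lemma gauss_leN w B P : gauss_le w B P -> gauss_le w B (- P).
Proof. by move=> PB i; rewrite coefN vabsN. Qed.

Lemma gauss_le_sum w B n (F : nat -> {poly K}) : 0 <= w -> 0 <= B ->
  (forall k, gauss_le w B (F k)) -> gauss_le w B (\sum_(k < n) F k).
Proof.
move=> w0 B0 FB; elim/big_ind : _ => [i|P Q|k _]; last exact: FB.
  by rewrite coef0 vabs0 mul0r.
exact: gauss_leD.
Qed.

Lemma gauss_leM w A B P Q : 0 <= w -> 0 <= A -> 0 <= B ->
  gauss_le w A P -> gauss_le w B Q -> gauss_le w (A * B) (P * Q).
Proof.
move=> w0 A0 B0 PA QB i; rewrite coefM.
(* The bound is about to be divided by w^i. *)
have [->|wn0] := eqVneq (w ^+ i) 0; first by rewrite mulr0 mulr_ge0.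
have wi : 0 < w ^+ i by rewrite lt_neqAle eq_sym wn0 exprn_ge0.
rewrite -ler_pdivlMr//; apply: vabs_sum_le => [|j _].
  by rewrite divr_ge0 ?mulr_ge0// ltW.
rewrite ler_pdivlMr// vabsM -[in w ^+ i](subnKC (_ : j <= i)%N) -1?ltnS//.
by rewrite exprD mulrACA ler_pM ?mulr_ge0 ?vabs_ge0 ?exprn_ge0.
Qed.

Lemma gauss_leX w B P k : 0 <= w -> 0 <= B ->
  gauss_le w B P -> gauss_le w (B ^+ k) (P ^+ k).
Proof.
move=> w0 B0 PB; elim: k => [[|i]|k IHk].
- by rewrite !expr0 coef1 vabs1 mulr1.
- by rewrite !expr0 coef1 vabs0 mul0r ler01.
- by rewrite !exprS; apply: gauss_leM => //; rewrite exprn_ge0.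
Qed.

(** Turns agreement of coefficients up to degree [n] into an error bound: a term of index i > n is
    at most |P_i| w^i rho^i. *)
Lemma horner_small w rho P n (u : K) : 0 <= rho <= 1 ->
  gauss_le w 1 P -> (forall i, (i <= n)%N -> P`_i = 0) ->
  vabs u <= rho * w -> vabs P.[u] <= rho ^+ n.+1 :> R.
Proof.
move=> /andP[r0 r1] P1 P0 uw; rewrite horner_coef; apply: vabs_sum_le.
  by rewrite exprn_ge0.
move=> i _; have [/P0->|ni] := leqP i n.
  by rewrite mul0r vabs0 exprn_ge0.
rewrite vabsM vabsX.
have : vabs u ^+ i <= (rho * w) ^+ i :> R.
  by rewrite lerXn2r ?nnegrE ?vabs_ge0// (le_trans _ uw) ?vabs_ge0.
move=> /(ler_wpM2l (vabs_ge0 P`_i))/le_trans; apply.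
rewrite exprMn mulrCA (le_trans (ler_wpM2l _ (P1 i))) ?exprn_ge0// mulr1.
exact: ler_wiXn2l.
Qed.

End GaussNorm.

(** From Legendre's formula, by induction on the partial sums of the quotients of n by p^k. The
    radius p^(-1/(p-1)) has its origin here. *)
Lemma logn_fact_le p n : prime p -> (0 < n)%N -> (p.-1 * logn p n`! <= n.-1)%N.
Proof.
move=> p_pr n0; rewrite logn_fact//.
have p1 := prime_gt1 p_pr.
(* The maximum keeps the inequality strict once [n %/ p ^ m = 0]. *)
suff H m :
    (p.-1 * (\sum_(1 <= k < m.+1) n %/ p ^ k) + maxn (n %/ p ^ m) 1 <= n)%N.
  by have := H n; lia.
elim: m => [|m IHm]; first by rewrite big_nil muln0 expn0 divn1; lia.
rewrite big_nat_recr//= expnSr divnMA mulnDr.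
move: IHm; set S := \sum_(_ <= _ < _) _; move: (_ %/ p ^ m)%N => f.
have [->|] := posnP (f %/ p)%N; first by lia.
have := leq_trunc_div f p.
nia.
Qed.

(** * The p-adic exponential and logarithm *)

Definition exp_radius (R : realType) (p : nat) : R :=
  p%:R `^ (- (p.-1%:R)^-1).
Arguments exp_radius {R} p.

Section PadicExponential.
Context {R : realType} {K : valuedFieldType R} {p : nat}.
Context (p_prime : prime p) (Kc : vcomplete K).
Context (vabs_nat : forall m, (0 < m)%N ->
  vabs (m%:R : K) = p%:R ^- logn p m :> R).
Implicit Types (a b q u z : K) (rho : R).

Local Notation r := (exp_radius p : R).

Let p0 : 0 < p%:R :> R. Proof. by rewrite ltr0n prime_gt0. Qed.

Lemma exp_radius_gt0 : 0 < r.
Proof. exact: powR_gt0. Qed.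

Let r_ge0 : 0 <= r := ltW exp_radius_gt0.

Lemma exp_radiusX : r ^+ p.-1 = p%:R^-1.
Proof.
rewrite -powR_mulrn// -powRrM mulNr mulVf ?powR_inv1 ?ltW//.
by rewrite pnatr_eq0 -lt0n -ltnS prednK ?prime_gt1 ?prime_gt0.
Qed.

Lemma exp_radius_le1 : r <= 1.
Proof.
rewrite -[leRHS](powRr0 p%:R) ler_powR// ?oppr_le0 ?invr_ge0//.
by rewrite ler1n prime_gt0.
Qed.

Lemma vpchar0 : [pchar K] =i pred0.
Proof.
apply/pcharf0P; case=> [|m]; first by rewrite !eqxx.
apply/negbTE/eqP => /(congr1 vabs)/eqP.
by rewrite vabs_nat// vabs0 invr_eq0 expf_eq0 (gt_eqF p0) andbF.
Qed.

(** The exponent [k.-1], sharper than [k], is what the Lipschitz bound [vabs_exp_sumB] needs. *)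
Lemma vabs_fact_ge k : r ^+ k.-1 <= vabs (k`!%:R : K).
Proof.
case: k => [|k]; first by rewrite expr0 vabs1.
rewrite vabs_nat ?fact_gt0// -exprVn -exp_radiusX -exprM.
apply: ler_wiXn2l => //; first exact: exp_radius_le1.
exact: logn_fact_le.
Qed.

Lemma vabs_fact_geX k : r ^+ k <= vabs (k`!%:R : K).
Proof.
by rewrite (le_trans _ (vabs_fact_ge k))// ler_wiXn2l ?exp_radius_le1 ?leq_pred.
Qed.

(** Since (k+1)! = (k+1) k! and |k!| <= 1, the bound for the factorial passes to its factor k+1. *)
Lemma vabs_nat_ge k : r ^+ k <= vabs (k.+1%:R : K).
Proof.
rewrite (le_trans (vabs_fact_ge k.+1))// factS natrM vabsM.
by rewrite ler_piMr ?vabs_ge0 ?vabs_nat_le1.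
Qed.

Lemma vabs_fact_gt0 k : 0 < vabs (k`!%:R : K) :> R.
Proof.
by rewrite (lt_le_trans _ (vabs_fact_geX k)) ?exprn_gt0 ?exp_radius_gt0.
Qed.

Lemma vabs_nat_gt0 k : 0 < vabs (k.+1%:R : K) :> R.
Proof.
by rewrite (lt_le_trans _ (vabs_nat_ge k)) ?exprn_gt0 ?exp_radius_gt0.
Qed.

Lemma vabs_exp_term rho a k : 0 <= rho -> vabs a <= rho * r ->
  vabs (a ^+ k / k`!%:R) <= rho ^+ k.
Proof.
move=> rho0 ar; rewrite vabsM vabsX vabsV.
rewrite ler_pdivrMr ?vabs_fact_gt0//.
rewrite (le_trans (_ : _ <= (rho * r) ^+ k))//.
  by rewrite lerXn2r ?nnegrE ?vabs_ge0 ?mulr_ge0.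
by rewrite exprMn ler_wpM2l ?exprn_ge0 ?vabs_fact_geX.
Qed.

(** Dividing by k > 0 costs at most k - 1 powers of [r], so one factor [r] remains; the term of
    index 0 vanishes because 0 has inverse 0. *)
Lemma vabs_log_term rho u k : 0 <= rho -> vabs u <= rho * r ->
  vabs ((-1) ^+ k.+1 * u ^+ k / k%:R) <= r * rho ^+ k.
Proof.
move=> rho0 ur; case: k => [|k].
  by rewrite invr0 mulr0 vabs0 mulr1.
rewrite vabsM vabsV vabsM !vabsX vabsN vabs1 expr1n mul1r.
rewrite ler_pdivrMr ?vabs_nat_gt0//.
rewrite (le_trans (_ : _ <= (rho * r) ^+ k.+1))//.
  by rewrite lerXn2r ?nnegrE ?vabs_ge0 ?mulr_ge0.
rewrite exprMn (exprS r) mulrCA mulrA.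
by rewrite ler_wpM2l ?mulr_ge0 ?exprn_ge0 ?vabs_nat_ge.
Qed.

Definition exp_sum n a : K := \sum_(k < n.+1) a ^+ k / k`!%:R.

Lemma exp_sum_cvg rho a : 0 <= rho < 1 -> vabs a <= rho * r ->
  vcvg (exp_sum^~ a) (padic_exp a).
Proof.
move=> rho01 ar; have : vcvg (series (fun k => a ^+ k / k`!%:R)) (padic_exp a).
  apply: (@vseries_cvg _ _ _ 1 rho) => // k.
  by rewrite mul1r vabs_exp_term//; case/andP: rho01.
move/vcvg_shift; congr (vcvg _ _); apply/funext => n.
by rewrite /series /= big_mkord.
Qed.

(** In a^k - b^k the cofactor of a - b is homogeneous of degree k - 1, hence at most r^(k-1) <=
    |k!|. The constant 1 is uniform in [n]. *)
Lemma vabs_exp_sumB n a b : vabs a <= r -> vabs b <= r ->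
  vabs (exp_sum n a - exp_sum n b) <= vabs (a - b) :> R.
Proof.
move=> ar br; rewrite /exp_sum -sumrB; apply: vabs_sum_le => [|k _].
  exact: vabs_ge0.
rewrite -mulrBl subrXX !vabsM vabsV -mulrA ler_piMr ?vabs_ge0//.
rewrite ler_pdivrMr ?vabs_fact_gt0//.
rewrite mul1r (le_trans _ (vabs_fact_ge k))//; apply: vabs_sum_le => [|i _].
  by rewrite exprn_ge0.
have ik : (i <= k.-1)%N by rewrite -ltnS (leq_trans (ltn_ord i)) ?leqSpred.
rewrite -[in leRHS](subnK ik) exprD vabsM !vabsX.
by rewrite ler_pM ?exprn_ge0 ?vabs_ge0 ?lerXn2r ?nnegrE ?vabs_ge0.
Qed.

Lemma padic_expD rho a b : 0 < rho < 1 ->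
  vabs a <= rho * r -> vabs b <= rho * r ->
  padic_exp (a + b) = padic_exp a * padic_exp b.
Proof.
move=> /andP[rho0 rho1] ar br.
have abr : vabs (a + b) <= rho * r.
  by rewrite (le_trans (vabsD_max _ _))// ge_max ar.
have rho01 : 0 <= rho < 1 by rewrite ltW.
(* An auxiliary variable grades the sums: [E n c] truncates exp (c X) and is evaluated at 1, inside
   the disc of radius 1/rho where its Gauss norm is at most 1. *)
pose E n c : {poly K} := \poly_(i < n.+1) (c ^+ i / i`!%:R).
have EE n c : (E n c).[1] = exp_sum n c.
  by rewrite horner_poly; apply: eq_bigr => i _; rewrite expr1n mulr1.
have Eg n c : vabs c <= rho * r -> gauss_le rho^-1 1 (E n c).
  move=> cr i; rewrite coef_poly exprVn ler_pdivrMr ?exprn_gt0// mul1r.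
  case: ifP => _; last by rewrite vabs0 exprn_ge0// ltW.
  by rewrite vabs_exp_term// ltW.
apply: (vcvg_unique (exp_sum_cvg rho01 abr)).
have := vcvgM (exp_sum_cvg rho01 ar) (exp_sum_cvg rho01 br).
suff H : vcvg (fun n => exp_sum n (a + b) - exp_sum n a * exp_sum n b) 0.
  move=> /(vcvgD H); rewrite add0r; congr (vcvg _ _).
  by apply/funext => n; rewrite subrK.
apply: (@vcvg_geometric _ _ _ _ rho rho) => // n.
rewrite subr0 -exprS -!EE -hornerM -hornerN -hornerD.
apply: (@horner_small _ _ rho^-1); first by rewrite !ltW.
- apply: gauss_leD; rewrite ?invr_ge0 ?ltW//; first exact: Eg.
  apply: gauss_leN; rewrite -[1]mulr1.
  by apply: gauss_leM; rewrite ?invr_ge0 ?ler01 ?ltW//; exact: Eg.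
(* Up to degree [n] the coefficients agree by the binomial formula. *)
- move=> i ni; rewrite coefB coefMr coef_poly ltnS ni exprDn mulr_suml -sumrB.
  apply: big1 => j _; have ji : (j <= i)%N by rewrite -ltnS.
  rewrite !coef_poly !ltnS (leq_trans ji)// (leq_trans (leq_subr _ _))//.
  rewrite mulrACA -[_ *+ 'C(i, j)]mulr_natr -[_ * _ / i`!%:R]mulrA -mulrBr.
  rewrite [X in _ * X](_ : _ = 0) ?mulr0// -(bin_fact ji) !natrM !invfM.
  have c0 : ('C(i, j)%:R : K) != 0.
    by have/pcharf0P-> := vpchar0; rewrite -lt0n bin_gt0.
  by rewrite mulVKf// mulrC subrr.
- by rewrite vabs1 divff// gt_eqF.
Qed.

(** Taken as a value of [log1p_poly], so that [exp_sum] of it becomes a value of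
    [degenerate_exp_poly]. *)
Definition log_sum n u : K := (log1p_poly 1 1 n).[u].

Lemma log_sumE n u :
  log_sum n u = \sum_(k < n.+1) (-1) ^+ k.+1 * u ^+ k / k%:R.
Proof.
rewrite /log_sum horner_poly; apply: eq_bigr => k _.
by rewrite /fps_log1p expr1n invr1 !mul1r mulr1 mulrAC.
Qed.

Lemma log_sum_cvg rho q : 0 <= rho < 1 -> vabs (q - 1) <= rho * r ->
  vcvg (log_sum^~ (q - 1)) (padic_log q).
Proof.
move=> rho01 qr.
  have : vcvg (series (fun k => (-1) ^+ k.+1 * (q - 1) ^+ k / k%:R))
    (padic_log q).
  apply: (@vseries_cvg _ _ _ r rho) => // k.
  by apply: vabs_log_term => //; case/andP: rho01.
move/vcvg_shift; congr (vcvg _ _); apply/funext => n.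
by rewrite log_sumE /series /= big_mkord.
Qed.

Lemma vabs_log_sum n rho u : 0 <= rho <= 1 -> vabs u <= rho * r ->
  vabs (log_sum n u) <= rho * r.
Proof.
move=> /andP[rho0 rho1] ur; rewrite log_sumE; apply: vabs_sum_le => [|k _].
  by rewrite mulr_ge0.
(* At index 0 the general bound would only give [r]. *)
have [k0|k0] := posnP k; first by rewrite k0 invr0 mulr0 vabs0 mulr_ge0.
rewrite (le_trans (vabs_log_term k rho0 ur))// mulrC ler_wpM2r//.
by rewrite -[leRHS]expr1 ler_wiXn2l.
Qed.

Lemma vabs_padic_log rho q : 0 <= rho < 1 -> vabs (q - 1) <= rho * r ->
  vabs (padic_log q) <= rho * r.
Proof.
move=> rho01 qr; apply: (vcvg_lim_le (log_sum_cvg rho01 qr)) => n.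
by apply: vabs_log_sum => //; case/andP: rho01 => -> /ltW.
Qed.

(** The truncated logarithm has Gauss norm at most [r] at radius [r], so its k-th power has norm at
    most r^k <= |k!|. *)
Lemma gauss_exp_log n : gauss_le r 1 (degenerate_exp_poly (1 : K) 1 n).
Proof.
apply: (@gauss_le_sum _ _ r 1 _
  (fun k => k`!%:R^-1 *: log1p_poly 1 1 n ^+ k)) => //.
move=> k i; rewrite coefZ vabsM vabsV -mulrA mulrC.
rewrite ler_pdivrMr ?vabs_fact_gt0//.
rewrite mul1r (le_trans _ (vabs_fact_geX k))//.
apply: gauss_leX => // -[|j].
  by rewrite log1p_poly0 vabs0 mul0r.
rewrite coef_poly; case: ifP => _; last by rewrite vabs0 mul0r.
rewrite /fps_log1p invr1 mul1r expr1n mul1r mulr1.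
rewrite vabsM vabsX vabsN vabs1 expr1n mul1r vabsV mulrC.
rewrite ler_pdivrMr ?vabs_nat_gt0//.
by rewrite exprS ler_wpM2l// vabs_nat_ge.
Qed.

Lemma padic_exp_log rho q : 0 <= rho < 1 -> vabs (q - 1) <= rho * r ->
  padic_exp (padic_log q) = q.
Proof.
move=> rho01 qr; have /andP[rho0 rho1] := rho01.
have Lr := vabs_padic_log rho01 qr.
have rr : rho * r <= r by rewrite ler_piMl// ltW.
apply: (vcvg_unique (exp_sum_cvg rho01 Lr)).
(* First replace the logarithm by its truncation, using the Lipschitz bound; then [H2] compares
   polynomials in q - 1. *)
have H1 : vcvg (fun n => exp_sum n (padic_log q) -
                         exp_sum n (log_sum n (q - 1))) 0.
  apply: vcvg_le (log_sum_cvg rho01 qr) => n.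
  rewrite subr0 vabsBC vabs_exp_sumB ?(le_trans _ rr)//.
  by apply: vabs_log_sum; rewrite // rho0 ltW.
have H2 : vcvg (fun n => exp_sum n (log_sum n (q - 1))) q.
  apply: (@vcvg_geometric _ _ _ _ rho rho) => // n.
  have -> : exp_sum n (log_sum n (q - 1)) - q =
      (degenerate_exp_poly (1 : K) 1 n - ('X + 1)).[q - 1].
    rewrite hornerD hornerN hornerD hornerX hornerC subrK; congr (_ - _).
    rewrite /degenerate_exp_poly horner_sum; apply: eq_bigr => k _.
    by rewrite hornerZ horner_exp mulrC.
  rewrite -exprS; apply: (@horner_small _ _ r) => //; first by rewrite rho0 ltW.
    apply: gauss_leD => //; first exact: gauss_exp_log.
    apply: gauss_leN => -[|[|i]]; rewrite coefD coefX coef1.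
    - by rewrite add0r vabs1 mul1r.
    - by rewrite addr0 vabs1 mul1r expr1 exp_radius_le1.
    - by rewrite addr0 vabs0 mul0r.
  (* For [lambda] and [z] equal to 1 the falling factorial contains the factor 1 - 1 from index 2
     on, which leaves 1 + X. *)
  move=> i ni; rewrite coefB degenerate_exp_coef ?oner_eq0//; last first.
    exact: vpchar0.
  rewrite coefD coefX coef1 /degenerate_ffact; case: i ni => [|[|i]] _.
  - by rewrite big_ord0 divr1 add0r subrr.
  - by rewrite big_ord_recl big_ord0 mul0r subr0 !mulr1 divr1 addr0 subrr.
  - rewrite 2!big_ord_recl [X in _ * (X * _)](_ : _ = 0) ?mulr1 ?subrr//.
    by rewrite mul0r mulr0 mul0r addr0 subrr.
have := vcvgD H1 H2; rewrite add0r; congr (vcvg _ _).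
by apply/funext => n; rewrite subrK.
Qed.

End PadicExponential.

(** * Powers of q and fermionic sums *)

Section QNumbers.
Context {R : realType} {K : valuedFieldType R} {p : nat}.
Context (p_prime : prime p) (Kc : vcomplete K).
Context (vabs_nat : forall m, (0 < m)%N ->
  vabs (m%:R : K) = p%:R ^- logn p m :> R).
Context {q : K} (q1 : q != 1) (qr : vabs (q - 1) < exp_radius p :> R).
Local Notation r := (exp_radius p : R).

Let r_gt0 : 0 < r := exp_radius_gt0 p_prime.

(** The strict inequality on |q - 1| as a ratio below 1; q != 1 makes it positive, as [padic_expD]
    requires. *)
Let rho : R := vabs (q - 1) / r.

Let rho_gt0 : 0 < rho.
Proof.
rewrite divr_gt0// lt_neqAle vabs_ge0 andbT eq_sym.
by apply/eqP => /vabs_eq0/eqP; rewrite subr_eq0 (negbTE q1).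
Qed.

Let rho_lt1 : rho < 1.
Proof. by rewrite ltr_pdivrMr// mul1r. Qed.

Let rho01 : 0 <= rho < 1.
Proof. by rewrite ltW. Qed.

Let q_rho : vabs (q - 1) <= rho * r.
Proof. by rewrite divfK// gt_eqF. Qed.

(** Both z log q and log q lie in the disc where exp is multiplicative, and exp (log q) = q. *)
Lemma qpowS z : vabs z <= 1 :> R -> qpow q (z + 1) = qpow q z * q.
Proof.
move=> z1; have Lr := vabs_padic_log p_prime Kc vabs_nat rho01 q_rho.
rewrite /qpow mulrDl mul1r.
rewrite (padic_expD p_prime Kc vabs_nat (rho := rho)) ?rho_gt0//.
  by rewrite (padic_exp_log p_prime Kc vabs_nat rho01).
by rewrite vabsM (le_trans _ Lr)// ler_piMl ?vabs_ge0.
Qed.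

Lemma qpowDn z m : vabs z <= 1 :> R -> qpow q (z + m%:R) = qpow q z * q ^+ m.
Proof.
move=> z1; elim: m => [|m IHm]; first by rewrite addr0 mulr1.
rewrite -natr1 addrA qpowS ?IHm -?mulrA -?exprSr//.
by rewrite (le_trans (vabsD_max _ _))// ge_max z1 vabs_nat_le1.
Qed.

Lemma qpow0 : qpow q 0 = 1.
Proof.
rewrite /qpow mul0r.
have e0 : vabs (0 : K) <= rho * r by rewrite vabs0 mulr_ge0 ?ltW ?rho_gt0.
apply: (vcvg_unique (exp_sum_cvg p_prime Kc vabs_nat rho01 e0)).
have -> : exp_sum^~ (0 : K) = fun=> 1; last exact: vcvg_cst.
apply/funext => n; rewrite /exp_sum big_ord_recl expr0 divr1.
rewrite big1 ?addr0// => i _.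
by rewrite expr0n mul0r.
Qed.

Lemma qnum2 : qnum q 2%:R = 1 + q.
Proof.
have q1' : 1 - q != 0 by rewrite subr_eq0 eq_sym.
rewrite /qnum -[2%:R]add0r qpowDn ?vabs0 ?ler01// qpow0 mul1r.
have -> : 1 - q ^+ 2 = (1 - q) * (1 + q) by ring.
by rewrite mulrAC divff// mul1r.
Qed.

Let q_lt1 : vabs (q - 1) < 1 :> R.
Proof. by rewrite (lt_le_trans qr)// exp_radius_le1. Qed.

Lemma vabs_le1 (x : K) : vabs (x - 1) < 1 :> R -> vabs x <= 1 :> R.
Proof.
move=> x1; rewrite -[x](subrK 1) (le_trans (vabsD_max _ _))//.
by rewrite ge_max vabs1 lexx ltW.
Qed.

Lemma vabs_expB1 (x : K) m : vabs (x - 1) < 1 :> R ->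
  vabs (x ^+ m - 1) <= vabs (x - 1) :> R.
Proof.
move=> x1; rewrite subrX1 vabsM ler_piMr ?vabs_ge0//.
apply: vabs_sum_le => // i _.
by rewrite vabsX exprn_ile1 ?vabs_ge0 ?vabs_le1.
Qed.

(** In x^p - 1 = (x - 1)(1 + x + ... + x^(p-1)) the second factor is p plus terms x^i - 1, so each
    p-th power gains a factor [c]. *)
Lemma expp_cvg1 : vcvg (fun N => q ^+ (p ^ N)) 1.
Proof.
pose c : R := Num.max p%:R^-1 (vabs (q - 1)).
have c0 : 0 <= c by rewrite le_max vabs_ge0 orbT.
have c1 : c < 1.
  by rewrite gt_max q_lt1 andbT invf_lt1 ?ltr1n ?ltr0n ?prime_gt1 ?prime_gt0.
apply: (@vcvg_geometric _ _ _ _ 1 c); first by rewrite c0.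
elim=> [|N IHN]; first by rewrite expr0 mulr1 expn0 expr1 ltW.
have x1 : vabs (q ^+ (p ^ N) - 1) <= vabs (q - 1) :> R by apply: vabs_expB1.
rewrite expnSr exprM subrX1 vabsM exprSr mulrA ler_pM ?vabs_ge0//.
move: x1; set x := q ^+ _ => x1.
have -> : \sum_(i < p) x ^+ i = p%:R + \sum_(i < p) (x ^+ i - 1).
  by rewrite sumrB sumr_const card_ord addrC subrK.
rewrite (le_trans (vabsD_max _ _))// ge_max; apply/andP; split.
  rewrite vabs_nat ?prime_gt0// -[X in logn p X]expn1 pfactorK// expr1.
  by rewrite le_max lexx.
apply: vabs_sum_le => // i _.
rewrite (le_trans (vabs_expB1 _ _)) ?(le_lt_trans x1)//.
by rewrite le_max x1 orbT.
Qed.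

Context (p_odd : odd p).

(** Here 1 + x = 2 + (x - 1), and |2| = 1 because [p] is odd. *)
Lemma vabs_1D (x : K) : vabs (x - 1) < 1 :> R -> vabs (1 + x) = 1 :> R.
Proof.
move=> x1; apply/le_anti/andP; split.
  by rewrite (le_trans (vabsD_max _ _))// ge_max vabs1 lexx vabs_le1.
have : vabs (2%:R : K) = 1 :> R.
  rewrite vabs_nat// logn_prime// (_ : p == 2%N = false) ?expr0 ?invr1//.
  by apply: contraTF p_odd => /eqP->.
rewrite (_ : 2%:R = (1 + x) - (x - 1)); last by ring.
move=> h; have := vabsB_max (1 + x) (x - 1); rewrite h le_max.
by case/orP => // /(lt_le_trans x1); rewrite ltxx.
Qed.

Lemma onePX_neq0 m : 1 + q ^+ m != 0.
Proof.
apply/eqP => /(congr1 vabs)/eqP; rewrite vabs0 vabs_1D ?oner_eq0//.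
by rewrite (le_lt_trans (vabs_expB1 _ _)).
Qed.

(** A geometric sum of ratio -q^(j+1). As p^N is odd, the N-th term is the limit times (1 + x^(j+1))
    / (1 + x) with x = q^(p^N), a factor tending to 1. *)
Lemma fermionic_moment j :
  vcvg (fun N => (qnum_neg q (p ^ N))^-1 *
                 \sum_(0 <= y < p ^ N) (q ^+ y) ^+ j * (- q) ^+ y)
       ((1 + q) / (1 + q ^+ j.+1)).
Proof.
have H N : (qnum_neg q (p ^ N))^-1 *
    \sum_(0 <= y < p ^ N) (q ^+ y) ^+ j * (- q) ^+ y =
    (1 + q) / (1 + q ^+ j.+1) *
    ((1 + (q ^+ (p ^ N)) ^+ j.+1) / (1 + q ^+ (p ^ N))).
  have oddN : odd (p ^ N) by rewrite oddX p_odd orbT.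
  have sE : \sum_(0 <= y < p ^ N) (q ^+ y) ^+ j * (- q) ^+ y =
      (1 + (q ^+ (p ^ N)) ^+ j.+1) / (1 + q ^+ j.+1).
    apply: (mulIf (onePX_neq0 j.+1)); rewrite divfK ?onePX_neq0//.
    rewrite big_mkord [LHS]mulrC.
    have -> : 1 + q ^+ j.+1 = 1 - - q ^+ j.+1 by rewrite opprK.
    rewrite -exprM mulnC exprM -[q ^+ j.+1 in RHS]opprK [in RHS]exprNn.
    rewrite -signr_odd oddN expr1 mulN1r -[1 in RHS](expr1n _ (p ^ N)).
    rewrite subrXX; congr (_ * _); apply: eq_bigr => i _.
    by rewrite expr1n mul1r -exprM mulnC exprM -exprMn mulrN exprSr.
  rewrite sE /qnum_neg invf_div exprNn -signr_odd oddN expr1 mulN1r opprK.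
  by rewrite mulrACA [RHS]mulrACA; congr (_ * _); rewrite mulrC.
rewrite (funext H) -[(1 + q) / _ in X in vcvg _ X]mulr1; apply: vcvgMl.
apply: vcvg_le expp_cvg1 => N.
have qN1 : vabs (q ^+ (p ^ N) - 1) < 1 :> R.
  by rewrite (le_lt_trans (vabs_expB1 _ _)).
have := onePX_neq0 (p ^ N); have := vabs_1D qN1; move: qN1.
set x := q ^+ _ => x1 vx x0.
have -> : (1 + x ^+ j.+1) / (1 + x) - 1 = ((x ^+ j.+1 - 1) - (x - 1)) / (1 + x).
  by field.
rewrite vabsM vabsV vx invr1 mulr1 (le_trans (vabsB_max _ _))//.
by rewrite ge_max lexx vabs_expB1.
Qed.

(** Linearity over the moments; [Q] will be q^x. *)
Lemma fermionic_poly (P : {poly K}) (Q : K) :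
  vcvg (fun N => (qnum_neg q (p ^ N))^-1 *
                 \sum_(0 <= y < p ^ N) P.[Q * q ^+ y] * (- q) ^+ y)
       (\sum_(j < size P) P`_j * Q ^+ j * ((1 + q) / (1 + q ^+ j.+1))).
Proof.
have := @vcvg_sum _ _ (size P) _ _
  (fun j => vcvgMl (P`_j * Q ^+ j) (fermionic_moment j)).
congr (vcvg _ _); apply/funext => N.
under [in RHS]eq_bigr do rewrite horner_coef mulr_suml.
rewrite exchange_big mulr_sumr; apply: eq_bigr => j _.
rewrite mulrCA; congr (_ * _); rewrite mulr_sumr; apply: eq_bigr => y _.
by rewrite exprMn !mulrA.
Qed.

End QNumbers.

(** * Specialisation to C_p and the degenerate q-Euler polynomials *)

Section Tower.
Context {R : realType} {p : nat} (T : padicTower R p).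

(** All embeddings of the tower are isometric, so the value is read off in Q. This supplies the
    hypothesis [vabs_nat] of the earlier sections. *)
Lemma vabs_Cp_nat m : (0 < m)%N ->
  vabs (m%:R : Cp T) = p%:R ^- logn p m :> R.
Proof.
move=> m0.
have [vQp _ _] := Qp_completion T; have [_ _ vQpbar] := Qpbar_closure T.
have [vCp _ _] := Cp_completion T.
have <- : Qpbar_to_Cp T (Qp_to_Qpbar T (rat_to_Qp T m%:R)) = m%:R.
  by rewrite !rmorph_nat.
rewrite vCp vQpbar vQp /padic_abs pnatr_eq0 gtn_eqF//.
have -> : (m%:R : rat) = (m%:Z)%:~R by rewrite -pmulrn.
by rewrite numq_int denq_int /= logn1 expr0 mul1r.
Qed.

Lemma Zp_to_Cp_nat m : Zp_to_Cp (Defs.Zp_nat T m) = m%:R.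
Proof. by rewrite /Zp_to_Cp /= !rmorph_nat. Qed.

(** The variable stands for q^z, so that ([z]_q)_{n,lambda} is a polynomial value. *)
Definition qffact_poly (q lambda : Cp T) n : {poly Cp T} :=
  \prod_(i < n) ((1 - 'X) * ((1 - q)^-1)%:P - (i%:R * lambda)%:P).

Lemma horner_qffact q lambda n Q :
  (qffact_poly q lambda n).[Q] = degenerate_ffact lambda ((1 - Q) / (1 - q)) n.
Proof.
rewrite /qffact_poly horner_prod; apply: eq_bigr => i _.
by rewrite !hornerE.
Qed.

End Tower.

(** The sums defining the integral sample only natural [y], where q^(x+y) = q^x q^y follows from
    [qpowDn]; the integrand is P(q^x q^y) / n!. *)
Lemma degenerate_qEulerE (R : realType) (p : nat) (T : padicTower R p)
    (q lambda x : Cp T) (n : nat) :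
  prime p -> odd p -> q != 1 -> vabs (q - 1) < exp_radius p :> R ->
  lambda != 0 -> vabs x <= 1 :> R ->
  let P := qffact_poly q lambda n in
  degenerate_qEuler q lambda n x =
  \sum_(j < size P) P`_j * qpow q x ^+ j * ((1 + q) / (1 + q ^+ j.+1)).
Proof.
move=> p_pr p_odd q1 qr l0 x1 P.
have [_ Kc _] := Cp_completion T.
have c0 := vpchar0 p_pr (@vabs_Cp_nat _ _ T).
rewrite /degenerate_qEuler /fermionic_integral.
rewrite [X in _ * X](_ : _ = n`!%:R^-1 *
  \sum_(j < size P) P`_j * qpow q x ^+ j * ((1 + q) / (1 + q ^+ j.+1))).
  by rewrite mulVKf ?factr_neq0.
apply: vcvg_lim; have := vcvgMl n`!%:R^-1 (fermionic_poly p_pr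
  (@vabs_Cp_nat _ _ T) qr p_odd P (qpow q x)).
congr (vcvg _ _); apply/funext => N; rewrite mulrCA mulr_sumr.
congr (_ * _); apply: eq_bigr => y _.
rewrite fps_degenerate_expE// Zp_to_Cp_nat /qnum.
rewrite (qpowDn p_pr Kc (@vabs_Cp_nat _ _ T))// horner_qffact.
by rewrite mulrA [_^-1 * _]mulrC.
Qed.

Theorem theorem2p6 (R : realType) (p : nat) (T : padicTower R p)
    (q lambda x : Cp T) (n : nat) :
  prime p -> odd p ->
  q != 1 -> vabs (q - 1) < (p%:R : R) `^ (- (p.-1%:R)^-1) ->
  lambda != 0 -> vabs x <= 1 ->
  q * degenerate_qEuler q lambda n (x + 1) + degenerate_qEuler q lambda n x
  = qnum q 2%:R * degenerate_ffact lambda (qnum q x) n.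
Proof.
move=> p_pr p_odd q1 qr l0 x1.
have [_ Kc _] := Cp_completion T.
have vn := @vabs_Cp_nat _ _ T.
have x11 : vabs (x + 1) <= 1 :> R.
  by rewrite (le_trans (vabsD_max _ _))// ge_max x1 vabs1 lexx.
rewrite !degenerate_qEulerE// (qnum2 p_pr Kc vn q1 qr).
rewrite (qpowS p_pr Kc vn q1 qr)// -horner_qffact horner_coef !mulr_sumr.
rewrite -big_split; apply: eq_bigr => j _ /=.
(* Termwise, q (q^x q)^j + (q^x)^j = (q^x)^j (1 + q^(j+1)) cancels the denominator. *)
have := onePX_neq0 p_pr vn qr p_odd j.+1.
rewrite exprMn exprS; move: (qpow q x ^+ j) (q ^+ j) => Q w w0.
by field.
Qed.
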